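(* Let $q\ge1$ be real, $0<\beta<\beta_c(q)=\log(1+\sqrt q)$, $N\ge1$, $\Lambda=\{-N,\dots,N\}^2$, $\Lambda_+=\{-N,\dots,N\}\times\{0,\dots,N\}$ and $\Lambda_-=\{-N,\dots,N\}\times\{-N,\dots,-1\}$. For $a\ge0$ let $\Phi_{a,\Lambda}$ be the random-cluster measure on $\Lambda$ with free boundary condition, cluster weight $q$, edge weight $e^\beta-1$ on edges with both endpoints in $\Lambda_+$ and edge weight $a$ on edges of $\Lambda$ with an endpoint in $\Lambda_-$. Then, for any $u,v\in\Lambda_+$ and any $0\le a<e^\beta-1$, $$\Phi_{a,\Lambda}(u\leftrightarrow v)\le \Phi\Bigl(\mathbf 1_{\{u\leftrightarrow v\}}\,\bigl(1-\epsilon(a)\bigr)^{|\mathrm{Piv}(u\leftrightarrow v)\cap\Lambda_-|}\Bigr),\qquad \epsilon(a)=\frac{e^\beta-1-a}{(e^\beta-1+q)(e^\beta-1)},$$ where $\Phi$ is the infinite-volume random-cluster measure on $\mathbb Z^2$ with edge weight $e^\beta-1$ and cluster weight $q$, $\Phi(f)$ denotes the expectation of $f$ under $\Phi$, and $\mathrm{Piv}(u\leftrightarrow v)\cap\Lambda_-$ is the set of pivotal edges for $\{u\leftrightarrow v\}$ that are edges of $\Lambda$ with at least one endpoint in $\Lambda_-$.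
   Context: Random-cluster measure: for a finite graph $F=(V_F,E_F)$ and edge weights $w_e\ge0$, the measure with cluster weight $q$ and free boundary condition is the probability measure on $\omega\in\{0,1\}^{E_F}$ proportional to $\prod_{e:\omega_e=1}w_e\;q^{\kappa(\omega)}$, where $\kappa(\omega)$ is the number of connected components (including isolated vertices) of $(V_F,\omega)$. Boxes are regarded as subgraphs of the nearest-neighbour graph $\mathbb Z^2$. $\Phi$ is the limit of the finite-volume measures on square boxes with free boundary condition; it is the unique infinite-volume measure since $\beta<\beta_c(q)$. $u\leftrightarrow v$ means that $u,v$ are connected by a path of open edges. An edge $e$ is pivotal for an event $A$ in a configuration $\omega$ if exactly one of $\omega,\omega'$ belongs to $A$, where $\omega'$ is obtained from $\omega$ by changing the state of $e$ only; $\mathrm{Piv}(A)$ is the (random) set of pivotal edges for $A$. *)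

(* Defs.v *)
From HB Require Import structures.
From mathcomp Require Import all_boot all_order all_algebra finmap.
From mathcomp Require Import all_classical all_reals all_analysis.
From mathcomp Require Import zify.

Set Implicit Arguments.
Unset Strict Implicit.
Unset Printing Implicit Defensive.
Import Order.TTheory GRing.Theory Num.Theory.
Import numFieldNormedType.Exports.

Local Open Scope classical_set_scope.
Local Open Scope ring_scope.

(** A graph, finite or not, is given by its vertices [V], its edges [E] and the
    relation [joins e x y]: "[x] and [y] are the two endpoints of [e]". *)

Section Percolation.
Variables (V : eqType) (E : Type) (joins : E -> rel V).

Definition open_adj (w : E -> bool) : rel V :=
  fun x y => `[< exists2 e, w e & joins e x y >].

Definition connected (x y : V) : set (E -> bool) :=
  [set w | exists2 p, path (open_adj w) x p & last x p = y].

End Percolation.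

Definition flip (E : eqType) (w : E -> bool) (e : E) : E -> bool :=
  fun f => if f == e then ~~ w f else w f.

Definition pivotal (E : eqType) (A : set (E -> bool)) (w : E -> bool) (e : E)
    : bool :=
  (w \in A) != (flip w e \in A).

Section RandomCluster.
Variables (R : realType) (V E : finType) (joins : E -> rel V).
Variables (wt : E -> R) (q : R).

Definition kappa (omega : {ffun E -> bool}) : nat :=
  n_comp (open_adj joins omega) predT.

Definition rc_weight (omega : {ffun E -> bool}) : R :=
  (\prod_(e | omega e) wt e) * q ^+ kappa omega.

Definition rc_pmf (omega : {ffun E -> bool}) : R :=
  rc_weight omega / \sum_(eta : {ffun E -> bool}) rc_weight eta.

End RandomCluster.

Definition vertex : Type := (int * int)%type.

(** Every nearest-neighbour edge is represented exactly once, by its left (resp.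
    bottom) endpoint and its direction: [(x, false)] is the horizontal edge
    [{x, x + (1, 0)}] and [(x, true)] is the vertical edge [{x, x + (0, 1)}]. *)
Definition edge : Type := (vertex * bool)%type.

Definition endpoint1 (e : edge) : vertex := e.1.
Definition endpoint2 (e : edge) : vertex :=
  if e.2 then (e.1.1, e.1.2 + 1) else (e.1.1 + 1, e.1.2).

Definition joinsZ2 (e : edge) : rel vertex := fun x y =>
  [|| (endpoint1 e == x) && (endpoint2 e == y)
    | (endpoint1 e == y) && (endpoint2 e == x)].

Lemma joinsZ2P (x y : vertex) :
  (exists e, joinsZ2 e x y) <-> `|x.1 - y.1| + `|x.2 - y.2| = 1.
Proof.
split.
  move=> [] [[a b] []]; rewrite /joinsZ2 /endpoint1 /endpoint2 /=;
  case/orP => /andP[/eqP<- /eqP<-] /=; lia.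
case: x y => [a b] [c d] /= h.
have : ((c = a + 1 /\ d = b) \/ (c = a /\ d = b + 1)) \/
       ((a = c + 1 /\ b = d) \/ (a = c /\ b = d + 1)) by lia.
by case=> -[] [-> ->]; [exists (a, b, false) | exists (a, b, true)
  | exists (c, d, false) | exists (c, d, true)];
  rewrite /joinsZ2 /endpoint1 /endpoint2 /= !eqxx ?orbT.
Qed.

Definition box (n : nat) : {fset vertex} :=
  [fset (i%:Z - n%:Z, j%:Z - n%:Z)
    | i in iota 0 (2 * n + 1), j in iota 0 (2 * n + 1)]%fset.

Lemma in_box n (x : vertex) :
  (x \in box n) = (- n%:Z <= x.1 <= n%:Z) && (- n%:Z <= x.2 <= n%:Z).
Proof.
apply/imfset2P/idP => [[i /= hi [j /= hj ->]] /=|].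
  by move: hi hj; rewrite !mem_iota; lia.
case: x => a b /= h.
exists (absz (a + n%:Z)); first by rewrite /= mem_iota; lia.
exists (absz (b + n%:Z)); first by rewrite /= mem_iota; lia.
congr (_, _); lia.
Qed.

Definition box_edges (n : nat) : {fset edge} :=
  [fset e in box n `*` [fset false; true] | endpoint2 e \in box n]%fset.

Lemma in_box_edges n (e : edge) :
  (e \in box_edges n) = (endpoint1 e \in box n) && (endpoint2 e \in box n).
Proof.
by rewrite !inE; case: e.2; rewrite /= ?andbT.
Qed.

Definition joins_box (n : nat) (e : box_edges n) : rel (box n) :=
  fun x y => joinsZ2 (val e) (val x) (val y).

(** The one-edge cylinders generate the product sigma-algebra. *)
Definition open_edge (e : edge) : set (edge -> bool) := [set w | w e].

Definition config : Type := g_sigma_algebraType (range open_edge).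

HB.instance Definition _ := Measurable.on config.

(** Edges outside the box are closed, so that open paths from a vertex of the box
    in the extended configuration are open paths in the box. *)
Definition extend (n : nat) (omega : {ffun box_edges n -> bool}) : config :=
  fun e => if insub e is Some e' then omega e' else false.

(** The number of clusters is computed in the finite graph [box n]; only the
    resulting measure is transported to configurations of the whole lattice. *)
Definition rc_box (R : realType) (n : nat) (wt : edge -> R) (q : R)
    (A : set config) : R :=
  \sum_(omega : {ffun box_edges n -> bool} | extend omega \in A)
    rc_pmf (@joins_box n) (fun e => wt (val e)) q omega.

Definition local_event (A : set config) : Prop :=
  exists S : {fset edge}, forall w w' : config,
    (forall e, e \in S -> w e = w' e) -> A w -> A w'.

(** Weak convergence of the free measures on square boxes to [Phi]. Local events
    form a pi-system generating the sigma-algebra, so [Phi] is determined by it. *)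
Definition free_limit (R : realType) (p q : R) (Phi : probability config R)
    : Prop :=
  forall A : set config, local_event A ->
    (rc_box n (fun=> p) q A)%:E @[n --> \oo] --> Phi A.

Definition box_plus (N : nat) : {fset vertex} :=
  [fset x in box N | (0 <= x.2)%R]%fset.

Definition box_minus (N : nat) : {fset vertex} :=
  [fset x in box N | (x.2 <= -1)%R]%fset.

Definition edges_minus (N : nat) : {fset edge} :=
  [fset e in box_edges N
    | (endpoint1 e \in box_minus N) || (endpoint2 e \in box_minus N)]%fset.

Definition beta_c (R : realType) (q : R) : R := ln (1 + Num.sqrt q).

(** The remaining edges of [box N] have both endpoints in [box_plus N]. *)
Definition weight_a (R : realType) (N : nat) (beta a : R) (e : edge) : R :=
  if e \in edges_minus N then a else expR beta - 1.

Definition eps (R : realType) (beta q a : R) : R :=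
  (expR beta - 1 - a) / ((expR beta - 1 + q) * (expR beta - 1)).

Definition connect_event (u v : vertex) : set config := connected joinsZ2 u v.

Definition nb_piv_minus (N : nat) (u v : vertex) (w : config) : nat :=
  #|` [fset e in edges_minus N | pivotal (connect_event u v) w e]%fset|.

(* Main.v *)
(** Restore the weight [p = e^beta - 1] on the lower edges one at a time, each
    restored edge starting to be penalised by a factor [1 - eps] when it is
    pivotal. Write [F] for the penalised indicator, [x_a] and [x_p] for the
    probabilities that the current edge [e] is open with weights [a] and [p],
    and [mu_0], [mu_1] for the measures conditioned on the state of [e], which
    do not depend on its weight. One step amounts to
      [eps x_p mu_1(F; e pivotal) <= (x_p - x_a) (mu_1(F) - mu_0(F))].
    As [F] is increasing and vanishes with [e] closed when [e] is pivotal,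
    positive association ([q >= 1]) gives
      [mu_1(F; e pivotal) <= mu_1(F) - mu_0(F)],
    and [eps x_p <= x_p - x_a] because, leaving out the weight of [e], opening
    [e] does not increase the partition function. This bounds the left-hand side
    by the expectation of [F] under the free measure of the box. Positive
    association again bounds the latter by the free measures of larger boxes,
    for the increasing local function obtained by closing all edges outside of
    the box; in the limit, opening these edges back only increases [F]. *)

Require Import Defs.
From mathcomp Require Import all_boot all_order all_algebra finmap.
From mathcomp Require Import all_classical all_reals all_analysis.
From mathcomp Require Import ring lra zify.

Set Implicit Arguments.
Unset Strict Implicit.
Unset Printing Implicit Defensive.
Import Order.TTheory GRing.Theory Num.Theory.
Import numFieldNormedType.Exports.

Local Open Scope classical_set_scope.
Local Open Scope ring_scope.

(** * Four functions theorem on the subsets of a finite set *)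

Section FourFunctions.
Variables (R : realFieldType) (E : finType).
Implicit Types (X Y D : {set E}) (f : {set E} -> R).

Definition sum_edge (e : E) f X : R := f (e |: X) + f (X :\ e).

Definition sum_edges (s : seq E) f : {set E} -> R := foldr sum_edge f s.

Lemma setU1UU (e : E) X Y : (e |: X) :|: (e |: Y) = e |: (X :|: Y).
Proof. by apply/setP=> x; rewrite !inE; case: eqP. Qed.

Lemma setU1UD (e : E) X Y : (e |: X) :|: (Y :\ e) = e |: (X :|: Y).
Proof. by apply/setP=> x; rewrite !inE; case: eqP. Qed.

Lemma setU1ID (e : E) X Y : (e |: X) :&: (Y :\ e) = (X :&: Y) :\ e.
Proof. by apply/setP=> x; rewrite !inE; case: eqP; rewrite ?andbF. Qed.

Lemma setDUU1 (e : E) X Y : (X :\ e) :|: (e |: Y) = e |: (X :|: Y).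
Proof. by rewrite finset.setUC setU1UD [Y :|: X]finset.setUC. Qed.

Lemma setDIU1 (e : E) X Y : (X :\ e) :&: (e |: Y) = (X :&: Y) :\ e.
Proof. by rewrite finset.setIC setU1ID finset.setIC. Qed.

Lemma setDUD (e : E) X Y : (X :\ e) :|: (Y :\ e) = (X :|: Y) :\ e.
Proof. by rewrite finset.setDUl. Qed.

Lemma setDID (e : E) X Y : (X :\ e) :&: (Y :\ e) = (X :&: Y) :\ e.
Proof. by rewrite finset.setDIl. Qed.

Lemma setU1D (e : E) X : e |: (X :\ e) = e |: X.
Proof. by apply/setP=> x; rewrite !inE; case: eqP. Qed.

Lemma sum_sum_edge (e : E) f :
  \sum_X sum_edge e f X = (\sum_X f X) *+ 2.
Proof.
pose fl X := if e \in X then X :\ e else e |: X.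
have flK : involutive fl.
  move=> X; rewrite /fl; case: (boolP (e \in X)) => eX.
    by rewrite !inE eqxx /= finset.setD1K.
  by rewrite !inE eqxx /= finset.setU1K.
rewrite mulr2n [X in _ = _ + X](reindex_inj (inv_inj flK)) -big_split /=.
apply: eq_bigr => X _; rewrite /sum_edge /fl; case: ifP => eX.
  by rewrite (finset.setUidPr _) // finset.sub1set.
by rewrite addrC (finset.setDidPl _) // disjoint_sym finset.disjoints1 eX.
Qed.

Lemma sum_edges_const (s : seq E) f X Y :
  {subset [predC s] <= [pred e | (e \in X) == (e \in Y)]} ->
  sum_edges s f X = sum_edges s f Y.
Proof.
elim: s X Y => [|e s IH] X Y h /=.
  by congr f; apply/setP => x; apply/eqP; apply: h.
have hs x : x \notin s -> x != e -> (x \in X) = (x \in Y).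
  by move=> xs xe; apply/eqP/h; rewrite !inE negb_or xe xs.
rewrite /sum_edge; congr (_ + _); apply: IH => x; rewrite !inE => xs;
  by have := hs x xs; case: eqP => //= _ -> //.
Qed.

(** Each summed edge doubles the total over all sets; after all of them the function is constant, so
    its total is the same power of two times its value. *)
Lemma sum_edges_enum f X : sum_edges (enum E) f X = \sum_Y f Y.
Proof.
have h (s : seq E) : \sum_Y sum_edges s f Y = (\sum_Y f Y) *+ 2 ^ size s.
  elim: s => [|e s IH] //=; rewrite sum_sum_edge IH expnSr mulrnA //.
have := h (enum E).
rewrite (eq_bigr (fun=> sum_edges (enum E) f X)); last first.
  by move=> Y _; apply: sum_edges_const => x; rewrite !inE mem_enum.
rewrite sumr_const -finset.cardsT -finset.powersetT finset.card_powerset.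
rewrite finset.cardsT cardE => /eqP.
rewrite -subr_eq0 -mulrnBl mulrn_eq0 expn_eq0 /=.
by rewrite subr_eq0 => /eqP.
Qed.

(** The case of a single edge, the indices telling whether it is open. Products with equal indices
    compare directly, the mixed ones only through their sum. *)
Lemma four_points (a0 a1 b0 b1 c0 c1 d0 d1 : R) :
  0 <= a0 -> 0 <= a1 -> 0 <= b0 -> 0 <= b1 ->
  0 <= c0 -> 0 <= c1 -> 0 <= d0 -> 0 <= d1 ->
  a0 * b0 <= c0 * d0 -> a0 * b1 <= c1 * d0 -> a1 * b0 <= c1 * d0 ->
  a1 * b1 <= c1 * d1 ->
  (a1 + a0) * (b1 + b0) <= (c1 + c0) * (d1 + d0).
Proof.
move=> a0p a1p b0p b1p c0p c1p d0p d1p h00 h01 h10 h11.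
suff : a0 * b1 + a1 * b0 <= c1 * d0 + c0 * d1 by lra.
have h : (a0 * b1) * (a1 * b0) <= (c1 * d0) * (c0 * d1).
  have -> : (a0 * b1) * (a1 * b0) = (a0 * b0) * (a1 * b1) by ring.
  have -> : (c1 * d0) * (c0 * d1) = (c0 * d0) * (c1 * d1) by ring.
  by apply: ler_pM => //; apply: mulr_ge0.
have t0 : 0 <= c0 * d1 by apply: mulr_ge0.
have x0 : 0 <= a0 * b1 by apply: mulr_ge0.
have y0 : 0 <= a1 * b0 by apply: mulr_ge0.
move: h01 h10 h t0 x0 y0.
move: (a0 * b1) (a1 * b0) (c1 * d0) (c0 * d1) => x y z t xz yz h t0 x0 y0.
(* For [z > 0], multiply by [z]: as [x * y <= z * t], the difference is at least
   [(z - x) * (z - y)]. Otherwise [x] and [y] vanish. *)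
have [z0|z0] := ltrP 0 z; last by lra.
rewrite -(ler_pM2l z0).
have : 0 <= (z - x) * (z - y) by apply: mulr_ge0; lra.
nra.
Qed.

(* The four functions theorem of Ahlswede and Daykin, obtained by summing over
   the states of the edges one at a time. *)
Theorem four_functions (al be ga de : {set E} -> R) :
  (forall X, 0 <= al X) -> (forall X, 0 <= be X) ->
  (forall X, 0 <= ga X) -> (forall X, 0 <= de X) ->
  (forall X Y, al X * be Y <= ga (X :|: Y) * de (X :&: Y)) ->
  (\sum_X al X) * (\sum_X be X) <= (\sum_X ga X) * (\sum_X de X).
Proof.
move=> al0 be0 ga0 de0 h.
have sum_edges_ge0 s f : (forall X, 0 <= f X) -> forall X, 0 <= sum_edges s f X.
  by move=> f0; elim: s => //= e s IH X; rewrite addr_ge0.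
suff /(_ (enum E) finset.set0 finset.set0) : forall s X Y,
    sum_edges s al X * sum_edges s be Y <=
    sum_edges s ga (X :|: Y) * sum_edges s de (X :&: Y).
  by rewrite !sum_edges_enum.
elim=> //= e s IH X Y; apply: four_points; rewrite ?sum_edges_ge0 //.
- by have := IH (X :\ e) (Y :\ e); rewrite setDUD setDID.
- by have := IH (X :\ e) (e |: Y); rewrite setDUU1 setDIU1.
- by have := IH (e |: X) (Y :\ e); rewrite setU1UD setU1ID.
- by have := IH (e |: X) (e |: Y); rewrite setU1UU -finset.setUIr.
Qed.

End FourFunctions.

(** * Connected components after the addition of one edge *)

Section AddEdge.
Variables (V : finType) (r : rel V) (x y : V).
Hypothesis r_sym : symmetric r.

Definition add_edge : rel V :=
  fun u v => r u v || ((x == u) && (y == v) || (x == v) && (y == u)).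

Lemma add_edge_sym : symmetric add_edge.
Proof. by move=> u v; rewrite /add_edge r_sym [X in _ || X]orbC. Qed.

Let cl : pred V := fun u => connect r x u || connect r y u.

(** The new edge merges the clusters of [x] and [y] into [cl] and leaves the others alone: each step
    of a path either stays in a cluster of [r] or has both ends in [cl]. *)
Lemma connect_add_edge u v :
  connect add_edge u v = connect r u v || cl u && cl v.
Proof.
have csym' := sym_connect_sym add_edge_sym.
have sub a b : connect r a b -> connect add_edge a b.
  by apply: connect_sub => {}a {}b h; apply: connect1; rewrite /add_edge h.
have xy : connect add_edge x y by apply: connect1; rewrite /add_edge !eqxx orbT.
apply/idP/idP; last first.
  case/orP => [/sub //|/andP[hu hv]].
  have clx w : cl w -> connect add_edge x w.
    by case/orP => /sub // h; apply: connect_trans xy h.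
  by apply: connect_trans (clx _ hv); rewrite csym'; apply: clx.
have cltr a b : connect r a b -> cl a = cl b.
  have aux c d : connect r c d -> cl c -> cl d.
    by move=> cd /orP[] h; rewrite /cl (connect_trans h cd) ?orbT.
  move=> ab; apply/idP/idP; apply: aux => //.
  by rewrite (sym_connect_sym r_sym).
case/connectP => p; elim: p u => [|w p IH] u /=.
  by move=> _ ->; rewrite connect0.
case/andP => /orP uw wp vE; have {IH wp vE} := IH _ wp vE.
have [uw'|uw'] : connect r u w \/ (cl u /\ cl w).
  case: uw => [/connect1|]; first by left.
  by case/orP => /andP[/eqP<- /eqP<-]; right; rewrite /cl !connect0 ?orbT.
- rewrite (cltr _ _ uw') => /orP[h|->]; rewrite ?orbT //.
  by rewrite (connect_trans uw' h).
- case: uw' => -> clw /orP[/cltr <-|/andP[_ ->]]; by rewrite ?clw ?orbT.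
Qed.

(** If [x] and [y] are already connected, connectivity is unchanged. Otherwise [cl] consists of two
    clusters before and one after, and its complement is unaffected. *)
Lemma n_comp_add_edge :
  n_comp r predT = (n_comp add_edge predT + ~~ connect r x y)%N.
Proof.
have csym := sym_connect_sym r_sym.
have csym' := sym_connect_sym add_edge_sym.
case: (boolP (connect r x y)) => xy.
  rewrite addn0; apply: eq_n_comp => u v; rewrite connect_add_edge.
  case: (boolP (connect r u v)) => //= uv; apply/esym/negP => /andP[hu hv].
  have clx w : cl w -> connect r x w.
    by case/orP => // h; apply: connect_trans xy h.
  case/negP: uv; apply: connect_trans (clx _ hv); rewrite csym; exact: clx.
rewrite (n_compC cl r) (n_compC cl add_edge) /=.
have -> : n_comp r cl = 2%N.
  have := n_comp_closure2 csym x y; rewrite xy => <-.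
  apply: eq_n_comp_r => z; rewrite unfold_in [RHS]unfold_in /cl.
  apply/idP/idP => [h|/pred0Pn[w]].
    apply/pred0Pn; case/orP: h => h; [exists x|exists y];
      by rewrite !inE eqxx ?orbT andbT csym.
  by rewrite !inE => /andP[zw /orP[]/eqP <-]; rewrite -!(csym z) zw ?orbT.
have -> : n_comp add_edge cl = 1%N.
  rewrite (eq_n_comp_r (a' := connect add_edge x)) ?n_comp_connect //.
  move=> z; change (cl z = connect add_edge x z).
  rewrite connect_add_edge /cl connect0 /=.
  by case: connect => //=.
suff -> : n_comp r [predC cl] = n_comp add_edge [predC cl] by rewrite addnAC.
apply: eq_card => z; rewrite !inE; case: (boolP (z \in cl)) => hz.
  by rewrite !andbF.
rewrite !andbT /roots /root; congr (odflt _ _ == _).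
apply: eq_pick => w.
by rewrite connect_add_edge -[cl z]/(z \in cl) (negPf hz) orbF.
Qed.

End AddEdge.

(** * Supermodularity of the number of clusters *)

Section Clusters.
Variables (V E : finType) (joins : E -> rel V) (s t : E -> V).
Hypothesis joinsE : forall e x y,
  joins e x y = (s e == x) && (t e == y) || (s e == y) && (t e == x).
Implicit Types A B : {set E}.

Definition clusters A : nat := n_comp (open_adj joins (fun e => e \in A)) predT.

Lemma open_adj_sym (w : E -> bool) : symmetric (open_adj joins w).
Proof.
move=> x y; apply/asboolP/asboolP => -[e we]; rewrite joinsE => h;
  by exists e => //; rewrite joinsE orbC.
Qed.

Lemma open_adj_setU1 e A :
  open_adj joins (fun f => f \in e |: A) =2
  add_edge (open_adj joins (fun f => f \in A)) (s e) (t e).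
Proof.
move=> x y; rewrite /add_edge -joinsE; apply/asboolP/orP.
  case=> f; rewrite in_setU1 => /orP[/eqP->|fA] h; first by right.
  by left; apply/asboolP; exists f.
case=> [/asboolP[f fA h]|h]; first by exists f => //; rewrite in_setU1 fA orbT.
by exists e => //; rewrite setU11.
Qed.

Lemma clusters_setU1 e A :
  clusters A = (clusters (e |: A) +
    ~~ connect (open_adj joins (fun f => f \in A)) (s e) (t e))%N.
Proof.
rewrite /clusters (n_comp_add_edge (s e) (t e)) //; last exact: open_adj_sym.
congr (_ + _)%N; apply/esym/eq_n_comp => x y.
by apply: eq_connect; apply: open_adj_setU1.
Qed.

Lemma clusters_setU1_le e A : (clusters (e |: A) <= clusters A)%N.
Proof. by rewrite (clusters_setU1 e A) leq_addr. Qed.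

Lemma connect_open_sub A B x y : A \subset B ->
  connect (open_adj joins (fun f => f \in A)) x y ->
  connect (open_adj joins (fun f => f \in B)) x y.
Proof.
move=> /fintype.subsetP AB; apply: connect_sub => {}x {}y /asboolP[e eA h].
by apply: connect1; apply/asboolP; exists e => //; apply: AB.
Qed.

(** An added edge lowers the count by one exactly when its endpoints are not yet connected; if this
    happens over a set, it happens over any smaller one. Adding the edges of [B] one by one to
    [A :&: B] and to [A] accumulates the inequality. *)
Lemma clusters_supermodular A B :
  (clusters A + clusters B <= clusters (A :|: B) + clusters (A :&: B))%N.
Proof.
have h (C D : {set E}) (r : seq E) : C \subset D ->
    (clusters D + clusters ([set:: r] :|: C) <=
     clusters ([set:: r] :|: D) + clusters C)%N.
  move=> CD; elim: r => [|e r IH].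
    by rewrite finset.set_nil !finset.set0U.
  rewrite finset.set_cons -!finset.setUA.
  have := clusters_setU1 e ([set:: r] :|: C).
  have := clusters_setU1 e ([set:: r] :|: D).
  have := @connect_open_sub _ _ (s e) (t e) (finset.setUS [set:: r] CD).
  case: connect => [/(_ isT) ->|_]; first by lia.
  by case: (connect _ _ _); lia.
have := h (A :&: B) A (enum B) (finset.subsetIl _ _).
rewrite finset.set_enum (finset.setUidPl (finset.subsetIr A B)) finset.setUC.
by lia.
Qed.

End Clusters.

(** * Increasing events penalised by their pivotal edges *)

Section PivotalWeight.
Variables (R : realFieldType) (E : choiceType) (C : set (E -> bool)) (s : R).
Hypothesis C_up : forall w w' : E -> bool,
  (forall e, w e -> w' e) -> C w -> C w'.
Hypotheses (s_ge0 : 0 <= s) (s_le1 : s <= 1).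
Implicit Types (T : {fset E}) (w : E -> bool) (e : E).

Definition piv_weight T w : R :=
  \1_C w * s ^+ #|` [fset e in T | pivotal C w e]%fset|.

Lemma piv_weight_ge0 T w : 0 <= piv_weight T w.
Proof. by rewrite mulr_ge0 // ?exprn_ge0 // indicE ler0n. Qed.

Lemma pivotal_closed w e : C w -> ~~ w e -> ~~ pivotal C w e.
Proof.
move=> Cw we; rewrite /pivotal negbK; apply/eqP.
rewrite !mem_set //; apply: C_up Cw => f wf; rewrite /flip.
by case: eqP => // fe; rewrite -fe wf in we.
Qed.

(** Opening edges preserves [C] and creates no pivotal edge once [C] holds, so for [s <= 1] the
    penalty only weakens. *)
Lemma piv_weight_le T w w' :
  (forall e, w e -> w' e) -> piv_weight T w <= piv_weight T w'.
Proof.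
move=> ww'; rewrite /piv_weight !indicE.
have [Cw|nCw] := boolP (w \in C); last first.
  by rewrite mul0r mulr_ge0 // exprn_ge0.
have Cw' : C w' by apply: C_up ww' _; apply: set_mem.
rewrite (mem_set Cw') !mul1r ler_wiXn2l //.
apply: fsubset_leq_card; apply/fsubsetP => e; rewrite !inE => /andP[-> /=] piv.
have w'e : w' e by apply: contraLR piv; apply: pivotal_closed.
move: piv; rewrite /pivotal Cw (mem_set Cw') /= => /negP piv.
apply/negP => /eqP/esym/eqP h; apply: piv; rewrite eq_sym.
(* Were [e] not pivotal for [w], [C] would hold in [flip w' e], which lies above [flip w e] if [e]
   is open in [w] and above [w] itself otherwise. *)
apply/eqP/mem_set; have [we|we] := boolP (w e).
  move: h => /eqP/set_mem; apply: C_up => f.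
  by rewrite /flip; case: eqP => [->|_]; rewrite ?we //; apply: ww'.
move: Cw => /set_mem; apply: C_up => f wf.
rewrite /flip; case: eqP => [fe|_]; last exact: ww'.
by rewrite -fe wf in we.
Qed.

Lemma piv_weight0 w : piv_weight fset0 w = \1_C w.
Proof.
rewrite /piv_weight (_ : [fset e in fset0 | pivotal C w e]%fset = fset0).
  by rewrite cardfs0 expr0 mulr1.
by apply/fsetP => e; rewrite !inE.
Qed.

Lemma piv_weight_closed T w e :
  ~~ w e -> piv_weight (e |` T)%fset w = piv_weight T w.
Proof.
move=> we; rewrite /piv_weight indicE.
have [Cw|nCw] := boolP (w \in C); last by rewrite !mul0r.
congr (_ * _ ^+ #|` _|); apply/fsetP => f; rewrite !inE.
case: eqP => //= ->.
by rewrite (negPf (pivotal_closed (set_mem Cw) we)) andbF.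
Qed.

Lemma piv_weight_open T w e : e \notin T -> w e ->
  piv_weight (e |` T)%fset w =
  (if flip w e \in C then 1 else s) * piv_weight T w.
Proof.
move=> eT we; rewrite /piv_weight indicE.
have [Cw|nCw] := boolP (w \in C); last by rewrite !mul0r mulr0.
rewrite !mul1r; case: ifP => piv.
  rewrite mul1r; congr (_ ^+ #|` _|); apply/fsetP => f; rewrite !inE.
  by case: eqP => //= ->; rewrite /pivotal Cw piv eqxx andbF.
rewrite -exprS; congr (_ ^+ _).
rewrite (_ : [fset f in e |` T | pivotal C w f]%fset =
   (e |` [fset f in T | pivotal C w f])%fset); last first.
  apply/fsetP => f; rewrite !inE; case: eqP => //= ->.
  by rewrite /pivotal Cw piv.
by rewrite cardfsU1 !inE (negPf eT).
Qed.

End PivotalWeight.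

(** * Random-cluster weights on sets of open edges, and positive association *)

Section LatticeMeasure.
Variables (R : realFieldType) (E : finType) (k : {set E} -> nat) (q : R).
Hypothesis k_super : forall A B, (k A + k B <= k (A :|: B) + k (A :&: B))%N.
Hypothesis q_ge1 : 1 <= q.
Implicit Types (A B X : {set E}) (w : E -> R) (f h : {set E} -> R).

Definition rcw w A : R := (\prod_(e in A) w e) * q ^+ k A.

Definition rc_mean w f : R := (\sum_A rcw w A * f A) / \sum_A rcw w A.

Lemma rcw_ge0 w A : (forall e, 0 <= w e) -> 0 <= rcw w A.
Proof.
move=> w0; apply: mulr_ge0; first by apply: prodr_ge0 => e _; apply: w0.
by rewrite exprn_ge0 // (le_trans ler01).
Qed.

Lemma rcw_sum_gt0 w : (forall e, 0 <= w e) -> 0 < \sum_A rcw w A.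
Proof.
move=> w0; rewrite (bigD1 finset.set0) //= ltr_wpDr //.
  by apply: sumr_ge0 => A _; apply: rcw_ge0.
by rewrite /rcw big_set0 mul1r exprn_gt0 // (lt_le_trans ltr01).
Qed.

(** The FKG lattice condition: the edge weights agree on both sides, and the powers of [q] compare
    by supermodularity of [k] and [q >= 1]. *)
Lemma rcw_lattice w A B : (forall e, 0 <= w e) ->
  rcw w A * rcw w B <= rcw w (A :|: B) * rcw w (A :&: B).
Proof.
move=> w0; rewrite /rcw mulrACA [leRHS]mulrACA -!exprD.
rewrite (_ : \prod_(e in A :|: B) w e * _ =
             \prod_(e in A) w e * \prod_(e in B) w e).
  apply: ler_wpM2l; last exact: ler_weXn2l.
  by rewrite mulr_ge0 //; apply: prodr_ge0 => e _; apply: w0.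
rewrite !(big_mkcond (fun e => e \in _)) /= -!big_split /=.
apply: eq_bigr => e _; rewrite finset.in_setU finset.in_setI.
by case: (e \in A); case: (e \in B); rewrite ?mulr1 ?mul1r.
Qed.

(** Closing all edges outside [D] lowers the mean of [h]. In the four functions theorem the
    constraint [A \subset D] is carried by the first and last functions, since intersections inherit
    it. *)
Lemma rcw_closed_le w (D : {set E}) h : (forall e, 0 <= w e) ->
  (forall A, 0 <= h A) ->
  (forall A B : {set E}, A \subset B -> h A <= h B) ->
  (\sum_(A : {set E} | A \subset D) rcw w A * h A) * (\sum_A rcw w A) <=
  (\sum_A rcw w A * h A) * (\sum_(A : {set E} | A \subset D) rcw w A).
Proof.
move=> w0 h0 hh; rewrite !(big_mkcond (fun A : {set E} => A \subset D)) /=.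
have r0 := fun A => rcw_ge0 A w0.
have rh0 A : 0 <= rcw w A * h A by apply: mulr_ge0.
apply: four_functions => // [A|A|A B]; [by case: ifP|by case: ifP|].
case: ifP => [AD|_]; last by rewrite mul0r mulr_ge0 //; case: ifP.
rewrite (fintype.subset_trans (finset.subsetIl A B) AD) mulrAC.
rewrite [leRHS]mulrAC; apply: ler_pM => //; first exact: mulr_ge0.
- exact: rcw_lattice.
- by apply: hh; apply: finset.subsetUl.
Qed.

(** Positive association between the measures conditioned on [e] closed and on [e] open. Both are
    summed over all sets [A], the state of [e] in [A] being overridden inside the weight. *)
Lemma rcw_cond_le w e h : (forall e, 0 <= w e) -> (forall A, 0 <= h A) ->
  (forall A B : {set E}, A \subset B -> h A <= h B) ->
  (\sum_A rcw w (A :\ e)%SET * h A) * (\sum_A rcw w (e |: A)) <=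
  (\sum_A rcw w (e |: A) * h A) * (\sum_A rcw w (A :\ e)%SET).
Proof.
move=> w0 h0 hh; have r0 := fun A => rcw_ge0 A w0.
apply: four_functions => // [A|A|A B]; [exact: mulr_ge0|exact: mulr_ge0|].
rewrite mulrAC [leRHS]mulrAC; apply: ler_pM => //; first exact: mulr_ge0.
  by have := rcw_lattice (A :\ e) (e |: B) w0; rewrite setDUU1 setDIU1.
by apply: hh; apply: finset.subsetUl.
Qed.

(** Giving weight 1 to [e] in [w1] makes the sum affine in [w e] with coefficients free of it; the
    factor 2 comes from summing both states of [e] over all sets. *)
Lemma rc_sum_edge w w1 e f : w1 e = 1 -> (forall g, g != e -> w1 g = w g) ->
  (\sum_A rcw w A * f A) *+ 2 =
  w e * (\sum_A rcw w1 (e |: A) * f (e |: A)) +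
  \sum_A rcw w1 (A :\ e) * f (A :\ e)%SET.
Proof.
move=> w1e w1g; rewrite -(sum_sum_edge e) mulr_sumr -big_split /=.
apply: eq_bigr => A _; rewrite /sum_edge mulrA; congr (_ * _ + _ * _).
  rewrite /rcw mulrA; congr (_ * _).
  rewrite -setU1D !(big_setU1 (e : E)) ?finset.in_setD1 ?eqxx //= w1e mul1r.
  congr (_ * _); apply: eq_bigr => g; rewrite finset.in_setD1 => /andP[ge _].
  by rewrite w1g.
rewrite /rcw; congr (_ * _); apply: eq_bigr => g.
by rewrite finset.in_setD1 => /andP[ge _]; rewrite w1g.
Qed.

Lemma rc_mean_edge w w1 e f : w1 e = 1 -> (forall g, g != e -> w1 g = w g) ->
  rc_mean w f =
  (w e * (\sum_A rcw w1 (e |: A) * f (e |: A)) +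
     \sum_A rcw w1 (A :\ e)%SET * f (A :\ e)%SET) /
  (w e * (\sum_A rcw w1 (e |: A)) + \sum_A rcw w1 (A :\ e)%SET).
Proof.
move=> w1e w1g; rewrite -(rc_sum_edge f w1e w1g).
have <- : (\sum_A rcw w A) *+ 2 =
    w e * (\sum_A rcw w1 (e |: A)) + \sum_A rcw w1 (A :\ e)%SET.
  have sum1 (g : {set E} -> R) : \sum_A g A * 1 = \sum_A g A.
    by apply: eq_bigr => A _; rewrite mulr1.
  by have := rc_sum_edge (fun=> 1) w1e w1g; rewrite !sum1.
rewrite /rc_mean; set x := \sum_A _; set y := \sum_A _.
rewrite -[x *+ 2]mulr_natr -[y *+ 2]mulr_natr -mulf_div.
by rewrite divff ?mulr1 ?pnatr_eq0.
Qed.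

End LatticeMeasure.

(* [A0], [B0] (resp. [A1], [B1]) are the contributions to the partition function
   and to the numerator of the configurations where the current edge is closed
   (resp. open), without the weight of that edge; [H1] is obtained from [B1] by
   evaluating the function as if the edge were closed. *)
Lemma edge_ratio_le (R : realFieldType) (a p q ep A0 A1 B0 B1 B1' H1 : R) :
  0 <= a -> a < p -> 1 <= q -> ep = (p - a) / ((p + q) * p) ->
  0 < A0 -> 0 <= A1 -> A1 <= A0 -> 0 <= H1 -> H1 <= B1 ->
  B0 * A1 <= H1 * A0 -> (1 - ep) * B1 + ep * H1 <= B1' ->
  (a * B1 + B0) / (a * A1 + A0) <= (p * B1' + B0) / (p * A1 + A0).
Proof.
move=> a_ge0 ap q_ge1 ep_def A0p A1p A10 H1p HB BH hB1'.
have p0 : 0 < p by apply: le_lt_trans ap.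
have epE : ep * p = (p - a) / (p + q).
  by rewrite ep_def invfM mulrA divfK ?gt_eqF.
(* This is where the value of [ep] enters, through [1 + a <= p + q]. *)
have ep_le : ep * p * (1 + a) <= p - a.
  rewrite epE -mulrA ler_piMr //; first by rewrite subr_ge0 ltW.
  rewrite mulrC ler_pdivrMr ?mul1r; lra.
have ep0 : 0 <= ep * p by rewrite epE divr_ge0 //; lra.
have Za : 0 < a * A1 + A0 by rewrite ltr_wpDl // mulr_ge0.
have Zp : 0 < p * A1 + A0 by rewrite ltr_wpDl // mulr_ge0 // ltW.
have h1 : p * ((1 - ep) * B1 + ep * H1) <= p * B1' by rewrite ler_pM2l.
(* With [B1'] replaced by its lower bound, the gap between the cross-multiplied sides is exactly the
   sum of the quantities in [h2] and [h3]. *)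
have h2 : 0 <= (B1 - H1) * ((p - a - ep * p) * A0 - ep * p * a * A1).
  apply: mulr_ge0; first by rewrite subr_ge0.
  have : ep * p * a * A1 <= ep * p * a * A0.
    by apply: ler_wpM2l => //; apply: mulr_ge0.
  have : ep * p * (1 + a) * A0 <= (p - a) * A0 by rewrite ler_pM2r.
  lra.
have h3 : 0 <= (p - a) * (H1 * A0 - B0 * A1).
  by apply: mulr_ge0; rewrite subr_ge0 // ltW.
rewrite ler_pdivrMr // mulrAC ler_pdivlMr //.
apply: (@le_trans _ _ ((p * ((1 - ep) * B1 + ep * H1) + B0) * (a * A1 + A0))).
  rewrite -subr_ge0; apply: le_trans (addr_ge0 h2 h3) _.
  by rewrite le_eqVlt; apply/orP; left; apply/eqP; ring.
by apply: ler_wpM2r; [exact: ltW|rewrite lerD2r].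
Qed.

(** * Restoring the weights of a list of edges one at a time *)

Section EdgeStep.
Variables (R : realFieldType) (E : finType) (k : {set E} -> nat) (q : R).
Hypothesis k_super : forall A B, (k A + k B <= k (A :|: B) + k (A :&: B))%N.
Hypothesis k_anti : forall e A, (k (e |: A) <= k A)%N.
Hypothesis q_ge1 : 1 <= q.
Variables (C : set (E -> bool)).
Hypothesis C_up : forall w w' : E -> bool,
  (forall e, w e -> w' e) -> C w -> C w'.
Variables (a p : R).
Hypotheses (a_ge0 : 0 <= a) (ap : a < p).

Let ep := (p - a) / ((p + q) * p).
Let F T (A : {set E}) := piv_weight C (1 - ep) T (fun e => e \in A).

Lemma penalty_itv : 0 <= ep <= 1.
Proof.
have p0 : 0 < p by apply: le_lt_trans ap.
have pq0 : 0 < p + q by apply: addr_gt0 => //; apply: lt_le_trans q_ge1.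
have pqp : 0 < (p + q) * p by apply: mulr_gt0.
apply/andP; split; first by apply: divr_ge0; [rewrite subr_ge0|]; apply: ltW.
rewrite /ep ler_pdivrMr // mul1r (@le_trans _ _ p) ?gerBl //.
by rewrite ler_peMl //; [exact: ltW|apply: le_trans q_ge1 _; rewrite lerDr ltW].
Qed.

Lemma penalised_ge0 T A : 0 <= F T A.
Proof. by apply: piv_weight_ge0; case/andP: penalty_itv; rewrite subr_ge0. Qed.

Lemma penalised_le T (A B : {set E}) : A \subset B -> F T A <= F T B.
Proof.
move=> /fintype.subsetP AB; case/andP: penalty_itv => ep0 ep1.
by apply: piv_weight_le => //; rewrite ?subr_ge0 // gerBl.
Qed.

Lemma rc_mean_step (w w' : E -> R) e (T : {fset E}) : e \notin T ->
  (forall g, 0 <= w g) -> w e = a -> w' e = p ->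
  (forall g, g != e -> w' g = w g) ->
  rc_mean k q w (F T) <= rc_mean k q w' (F (e |` T)%fset).
Proof.
move=> eT w0 we w'e w'g.
pose w1 g := if g == e then 1 else w g.
have w1e : w1 e = 1 by rewrite /w1 eqxx.
have w1g g : g != e -> w1 g = w g by rewrite /w1 => /negPf ->.
have w1g' g : g != e -> w1 g = w' g by move=> ge; rewrite w1g ?w'g.
have w10 g : 0 <= w1 g by rewrite /w1; case: eqP.
have r0 A : 0 <= rcw k q w1 A by apply: rcw_ge0.
rewrite (rc_mean_edge _ _ _ w1e w1g) (rc_mean_edge _ _ _ w1e w1g') we w'e.
(* A closed edge is not pivotal when [C] holds, so both ratios share their closed contribution. *)
rewrite [X in (p * _ + X) / _](_ : _ =
    \sum_A rcw k q w1 (A :\ e) * F T (A :\ e)); last first.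
  apply: eq_bigr => A _; congr (_ * _); apply: piv_weight_closed => //.
  by rewrite finset.in_setD1 eqxx.
have Fe A : F T (A :\ e) <= F T (e |: A).
  apply: penalised_le; apply: fintype.subset_trans (finset.subsetDl _ _) _.
  exact: finset.subsetUr.
apply: (@edge_ratio_le _ a p q ep _ _ _ _ _
  (\sum_A rcw k q w1 (e |: A) * F T (A :\ e)%SET)) => //.
- rewrite (bigD1 finset.set0) //= ltr_wpDr //; first exact: sumr_ge0.
  rewrite /rcw big1 ?mul1r ?exprn_gt0 ?(lt_le_trans ltr01) // => g.
  by rewrite !finset.in_setD1 finset.in_set0 andbF.
- exact: sumr_ge0.
- apply: ler_sum => A _; rewrite /rcw -setU1D.
  rewrite big_setU1 ?finset.in_setD1 ?eqxx //=.
  rewrite w1e mul1r; apply: ler_wpM2l; first exact: prodr_ge0.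
  exact: ler_weXn2l.
- by apply: sumr_ge0 => A _; rewrite mulr_ge0 // penalised_ge0.
- by apply: ler_sum => A _; rewrite ler_wpM2l.
- apply: rcw_cond_le => // [A|A B AB]; first exact: penalised_ge0.
  by apply: penalised_le; apply: finset.setSD.
rewrite !mulr_sumr -big_split; apply: ler_sum => A _ /=.
rewrite !(mulrCA _ (rcw _ _ _ _)) -mulrDr; apply: ler_wpM2l => //.
rewrite {3}/F piv_weight_open ?finset.setU11 //.
rewrite (_ : flip _ e = (fun g => g \in A :\ e)); last first.
  apply/funext => g; rewrite /flip finset.in_setD1 finset.in_setU1.
  by case: eqVneq => [->|].
(* If the event survives the closing of [e], monotonicity of [F] gives the bound; if not,
   [F T (A :\ e)] vanishes and the two sides are equal. *)
case/andP: penalty_itv => ep0 ep1; case: ifPn => [_|nC].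
  have : ep * F T (A :\ e) <= ep * F T (e |: A) by apply: ler_wpM2l.
  by rewrite mul1r -/(F T (e |: A)); lra.
rewrite -/(F T (e |: A)) [F T (A :\ e)]/F /piv_weight indicE (negPf nC).
by rewrite mul0r mulr0 addr0.
Qed.

Theorem rc_mean_piv (w : E -> R) (r : seq E) : uniq r ->
  (forall g, 0 <= w g) -> (forall g, g \in r -> w g = a) ->
  rc_mean k q w (fun A => \1_C (fun e => e \in A)) <=
  rc_mean k q (fun g => if g \in r then p else w g) (F [fset g in r]%fset).
Proof.
have p0 : 0 <= p by apply/ltW/(le_lt_trans a_ge0).
elim: r => [_ w0 _|e r IH /= /andP[er ur] w0 wa].
  have -> : [fset g in [::]]%fset = fset0 :> {fset E}.
    by apply/fsetP => g; rewrite !inE.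
  rewrite le_eqVlt; apply/orP; left; apply/eqP; congr (_ / _).
  by apply: eq_bigr => A _; rewrite /F piv_weight0.
(* The tail is restored first; as [e] is not in it, [e] still has weight [a] for the last step. *)
apply: le_trans (IH ur w0 _) _ => [g gr|].
  by rewrite wa // in_cons gr orbT.
rewrite (_ : [fset g in e :: r]%fset = e |` [fset g in r])%fset; last first.
  by apply/fsetP => g; rewrite !inE.
apply: rc_mean_step.
- by rewrite !inE.
- by move=> g; case: ifP.
- by rewrite (negPf er) wa // in_cons eqxx.
- by rewrite in_cons eqxx.
- by move=> g /negPf ge; rewrite in_cons ge.
Qed.

End EdgeStep.

(** * Number of clusters in an embedded subgraph *)

Section Subgraph.
Variables (V E : finType) (joins : E -> rel V) (s t : E -> V).
Hypothesis joinsE : forall e x y,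
  joins e x y = (s e == x) && (t e == y) || (s e == y) && (t e == x).
Variables (V' E' : finType) (joins' : E' -> rel V').
Variables (i : E' -> E) (j : V' -> V).
Hypothesis j_inj : injective j.
Hypothesis joins_sub : forall e x y, joins (i e) (j x) (j y) = joins' e x y.
Hypotheses (s_sub : forall e, s (i e) \in codom j)
  (t_sub : forall e, t (i e) \in codom j).
Hypothesis joins'_sym : forall e, symmetric (joins' e).

(** No open edge leaves the image of [j], where the clusters are those of the subgraph; every other
    vertex is isolated and counts as one cluster. *)
Lemma clusters_sub (B : {set E'}) :
  clusters joins (i @: B) = (clusters joins' B + #|[predC codom j]|)%N.
Proof.
rewrite /clusters; set r := open_adj joins _; set r' := open_adj joins' _.
have rsym : symmetric r := open_adj_sym joinsE _.
have r'sym : symmetric r'.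
  by move=> x y; apply/asboolP/asboolP => -[e eB h]; exists e => //;
    rewrite joins'_sym.
have r_in x y : r x y -> x \in codom j.
  case/asboolP => _ /imsetP[e _ ->]; rewrite joinsE.
  by case/orP => /andP[/eqP sE /eqP tE]; [rewrite -sE|rewrite -tE].
have cl : fingraph.closed r [pred x | x \in codom j].
  by move=> x y rxy; rewrite (r_in x y) // (r_in y x) // rsym.
have rE x y : r (j x) (j y) = r' x y.
  apply/asboolP/asboolP => [[_ /imsetP[e eB ->]]|[e eB h]].
    by rewrite joins_sub => h; exists e.
  by exists (i e); rewrite ?joins_sub //; apply: imset_f.
rewrite (n_compC [pred x | x \in codom j]); congr (_ + _)%N.
  rewrite (adjunction_n_comp j (e' := r')) //.
  - by apply: eq_n_comp_r => x; rewrite inE; apply: codom_f.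
  - exact: sym_connect_sym.
  - exact: sym_connect_sym.
  apply: strict_adjunction => //; first exact: sym_connect_sym.
apply: eq_card => z; rewrite !inE andbC.
case: (boolP (z \in codom j)) => //= hz.
have iso w : connect r z w -> w = z.
  case/connectP => [[|w' p] //=] /andP[/r_in]; by rewrite (negPf hz).
by apply/eqP/iso/connect_root.
Qed.

End Subgraph.

(** * Random-cluster measures on boxes of the lattice *)

Lemma box_edges_end1 n (e : box_edges n) : endpoint1 (val e) \in box n.
Proof. by have := valP e; rewrite in_box_edges => /andP[]. Qed.

Lemma box_edges_end2 n (e : box_edges n) : endpoint2 (val e) \in box n.
Proof. by have := valP e; rewrite in_box_edges => /andP[]. Qed.

Definition box_end1 n (e : box_edges n) : box n := [` box_edges_end1 e]%fset.
Definition box_end2 n (e : box_edges n) : box n := [` box_edges_end2 e]%fset.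

Lemma joins_box_ends n (e : box_edges n) (x y : box n) : joins_box e x y =
  (box_end1 e == x) && (box_end2 e == y) ||
  (box_end1 e == y) && (box_end2 e == x).
Proof. by []. Qed.

(** [extend] for plain functions, convertible to it on finite functions. *)
Definition box_config n (w : box_edges n -> bool) : config :=
  fun e => if insub e is Some e' then w e' else false.

Lemma box_config_le n (w w' : box_edges n -> bool) :
  (forall e, w e -> w' e) -> forall e, box_config w e -> box_config w' e.
Proof. by move=> h e; rewrite /box_config; case: insub. Qed.

Lemma box_config_val n (w : box_edges n -> bool) e : box_config w (val e) = w e.
Proof. by rewrite /box_config valK. Qed.

Lemma connect_event_up u v (w w' : edge -> bool) :
  (forall e, w e -> w' e) -> connect_event u v w -> connect_event u v w'.
Proof.
move=> h [p up pv]; exists p => //; apply: sub_path up => x y.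
by move=> /asboolP[e we xy]; apply/asboolP; exists e => //; apply: h.
Qed.

Definition box_clusters n : {set box_edges n} -> nat :=
  clusters (@joins_box n).

Lemma box_clusters_supermodular n A B :
  (@box_clusters n A + box_clusters B <=
   box_clusters (A :|: B) + box_clusters (A :&: B))%N.
Proof. exact: clusters_supermodular (@joins_box_ends n) _ _. Qed.

Lemma box_clusters_setU1_le n e A :
  (@box_clusters n (e |: A) <= box_clusters A)%N.
Proof. exact: clusters_setU1_le (@joins_box_ends n) _ _. Qed.

Definition config_of n (A : {set box_edges n}) : config :=
  box_config (fun e => e \in A).

Lemma rc_boxE (R : realType) n (wt : edge -> R) (q : R) (A : set config) :
  rc_box n wt q A =
  rc_mean (@box_clusters n) q (fun e => wt (val e))
    (fun B => \1_A (config_of B)).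
Proof.
pose set_of (w : {ffun box_edges n -> bool}) : {set box_edges n} :=
  [set e | w e]%SET.
have bij : bijective set_of.
  exists (fun B : {set box_edges n} => [ffun e => e \in B]) => [w|B].
    by apply/ffunP => e; rewrite ffunE finset.in_set.
  by apply/setP => e; rewrite finset.in_set ffunE.
have memE w : (fun e => e \in set_of w) = w :> (_ -> bool).
  by apply/funext => e; rewrite finset.in_set.
have wE w : rc_weight (@joins_box n) (fun e => wt (val e)) q w =
            rcw (@box_clusters n) q (fun e => wt (val e)) (set_of w).
  rewrite /rc_weight /rcw /box_clusters /clusters memE; congr (_ * _).
  by apply: eq_bigl => e; rewrite finset.in_set.
rewrite /rc_mean.
have -> : \sum_B rcw (@box_clusters n) q (fun e => wt (val e)) B =
    \sum_w rc_weight (@joins_box n) (fun e => wt (val e)) q w.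
  rewrite (reindex set_of) /=; last exact: onW_bij.
  by apply: eq_bigr => w _; rewrite wE.
rewrite (reindex set_of) /=; last exact: onW_bij.
rewrite mulr_suml /rc_box big_mkcond; apply: eq_bigr => w _.
rewrite indicE /config_of memE -[box_config w]/(extend w) /rc_pmf.
have [_|_] := boolP (extend w \in A); last by rewrite mulr0 mul0r.
by rewrite wE [X in _ = X / _]mulr1.
Qed.

(** * Comparison of free measures on nested boxes *)

Section Enlarge.
Variables (N n : nat) (Nn : (N <= n)%N).

Lemma box_sub : (box N `<=` box n)%fset.
Proof. by apply/fsubsetP => x; rewrite !in_box; lia. Qed.

Lemma box_edges_sub : (box_edges N `<=` box_edges n)%fset.
Proof.
apply/fsubsetP => e; rewrite !in_box_edges => /andP[h1 h2].
by rewrite !(fsubsetP box_sub).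
Qed.

Let i := fincl box_edges_sub.

Lemma box_clusters_sub (B : {set box_edges N}) :
  box_clusters (i @: B) =
  (box_clusters B + #|[predC codom (fincl box_sub)]|)%N.
Proof.
rewrite /box_clusters (clusters_sub (@joins_box_ends n) (joins' := @joins_box N)
  (j := fincl box_sub)) //.
- exact: fincl_inj.
- move=> e; apply/codomP; exists (box_end1 e); exact: val_inj.
- move=> e; apply/codomP; exists (box_end2 e); exact: val_inj.
- by move=> e x y; rewrite !joins_box_ends orbC.
Qed.

Variables (R : realType) (p q : R) (h : config -> R).
Hypotheses (p_ge0 : 0 <= p) (q_ge1 : 1 <= q).
Hypothesis h_ge0 : forall w, 0 <= h w.
Hypothesis h_le : forall w w' : config, (forall e, w e -> w' e) -> h w <= h w'.

Definition trunc (w : config) : config := fun e => (e \in box_edges N) && w e.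

(** Conditioned on all edges outside the smaller box being closed, the measure of the larger box is
    that of the smaller one: the extra vertices are isolated and contribute a factor [q ^+ c] that
    cancels. Then [rcw_closed_le] concludes. *)
Lemma rc_mean_enlarge :
  rc_mean (@box_clusters N) q (fun=> p) (fun B => h (config_of B)) <=
  rc_mean (@box_clusters n) q (fun=> p) (fun B => h (trunc (config_of B))).
Proof.
pose c := #|[predC codom (fincl box_sub)]|.
pose D : {set box_edges n} := i @: [set: _]%SET.
have i_inj : injective i by exact: fincl_inj.
have q_gt0 : 0 < q by apply: lt_le_trans q_ge1.
have reD (G : {set box_edges n} -> R) :
    \sum_(A : {set box_edges n} | A \subset D) G A =
    \sum_(B : {set box_edges N}) G (i @: B).
  rewrite (reindex_onto (fun B : {set box_edges N} => i @: B)
    (fun A => i @^-1: A)) /=.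
    apply: eq_bigl => B; rewrite finset.imsetS ?finset.subsetT //=.
    apply/eqP/setP => e; rewrite finset.inE; apply: finset.mem_imset.
    exact: i_inj.
  move=> A AD; apply/setP => e; apply/imsetP/idP => [[f]|eA].
    by rewrite finset.inE => fA ->.
  have /imsetP[f _ ef] := fintype.subsetP AD _ eA.
  by exists f => //; rewrite finset.inE -ef.
have rcwD (B : {set box_edges N}) : rcw (@box_clusters n) q (fun=> p) (i @: B) =
    q ^+ c * rcw (@box_clusters N) q (fun=> p) B.
  rewrite /rcw box_clusters_sub exprD mulrA mulrC -/c; congr (_ * (_ * _)).
  by rewrite !prodr_const card_imset.
have truncD (B : {set box_edges N}) : trunc (config_of (i @: B)) = config_of B.
  apply/funext => e; rewrite /trunc /config_of.
  have [eN|eN] := boolP (e \in box_edges N).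
    rewrite -[e]/(val [` eN]%fset) box_config_val.
    by rewrite -[val [` eN]%fset]/(val (i [` eN]%fset)) box_config_val
      finset.mem_imset.
  by rewrite andFb /box_config insubN.
have hm (A B : {set box_edges n}) :
    A \subset B -> h (trunc (config_of A)) <= h (trunc (config_of B)).
  move=> /fintype.subsetP AB; apply: h_le => e; rewrite /trunc => /andP[-> /=].
  exact: box_config_le.
have := rcw_closed_le (@box_clusters_supermodular n) q_ge1 D (fun _ => p_ge0)
  (fun A => h_ge0 (trunc (config_of A))) hm.
have Z0 m :
    0 < \sum_(B : {set box_edges m}) rcw (@box_clusters m) q (fun=> p) B.
  exact: rcw_sum_gt0.
rewrite !reD /rc_mean ler_pdivrMr // mulrAC ler_pdivlMr //.
under eq_bigr do rewrite rcwD truncD -mulrA.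
under [X in _ <= _ * X]eq_bigr do rewrite rcwD.
by rewrite -!mulr_sumr mulrCA -mulrA ler_pM2l ?exprn_gt0.
Qed.

End Enlarge.

(** The integral of a nonnegative function is a supremum over the simple functions below it. This
    form covers integrands whose measurability has not been established. *)
Lemma ge0_integral_le_pointwise d (T : measurableType d) (R : realType)
    (mu : {measure set T -> \bar R}) (f g : T -> \bar R) :
  (forall x, (0 <= f x)%E) -> (forall x, (f x <= g x)%E) ->
  (\int[mu]_x f x <= \int[mu]_x g x)%E.
Proof.
move=> f0 fg; have g0 x : (0 <= g x)%E by apply: le_trans (fg x).
rewrite !ge0_integralTE //; apply: le_ereal_sup => _ [h hf <-].
by exists h => // x; apply: le_trans (fg x).
Qed.

(** * Passage to the infinite-volume measure *)

Section Local.
Variable N : nat.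

Definition restrict (w : config) : {ffun box_edges N -> bool} :=
  [ffun e => w (val e)].

Definition cylinder (z : {ffun box_edges N -> bool}) : set config :=
  [set w | restrict w = z].

Lemma trunc_extend (w : config) : trunc N w = extend (restrict w).
Proof.
apply/funext => e; rewrite /trunc /extend.
have [eN|eN] := boolP (e \in box_edges N); last by rewrite andFb insubN.
by rewrite (insubT (fun e => e \in box_edges N) eN) ffunE.
Qed.

Lemma cylinder_local z : local_event (cylinder z).
Proof.
exists (box_edges N) => w w' ww' wz; rewrite /cylinder /= -wz.
by apply/ffunP => e; rewrite !ffunE ww' // (valP e).
Qed.

Lemma measurable_cylinder z : measurable (cylinder z : set config).
Proof.
have -> : cylinder z = \bigcap_(e in [set: box_edges N])
    (if z e then open_edge (val e) else ~` open_edge (val e)).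
  apply/seteqP; split => [w <- e _|w wz].
    by rewrite ffunE; case: ifP => [//|/negbT/negP].
  apply/ffunP => e; rewrite ffunE; have := wz e I.
  by case: (z e) => //= /negP/negPf.
apply: fin_bigcap_measurable => // e _.
have me : measurable (open_edge (val e) : set config).
  by apply: sub_sigma_algebra; exists (val e).
by case: (z e) => //; apply: measurableC.
Qed.

Variables (R : realType) (h : config -> R).
Hypothesis h_ge0 : forall w, 0 <= h w.

(** The truncated function depends on finitely many edges; this expansion reduces its expectation to
    probabilities of local events. *)
Lemma trunc_cylinders (w : config) :
  h (trunc N w) = \sum_z h (extend z) * \1_(cylinder z) w.
Proof.
rewrite (bigD1 (restrict w)) //= big1 => [|z zw].
  by rewrite indicE mem_set // mulr1 addr0 trunc_extend.
rewrite indicE memNset ?mulr0 // => wz.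
by case/eqP: zw; rewrite -wz.
Qed.

Lemma rc_mean_trunc (p q : R) n :
  rc_mean (@box_clusters n) q (fun=> p) (fun B => h (trunc N (config_of B))) =
  \sum_z h (extend z) * rc_box n (fun=> p) q (cylinder z).
Proof.
under [RHS]eq_bigr do rewrite rc_boxE /rc_mean mulrA mulr_sumr.
rewrite -mulr_suml exchange_big /rc_mean; congr (_ / _).
apply: eq_bigr => B _; rewrite trunc_cylinders mulr_sumr.
by apply: eq_bigr => z _; rewrite mulrCA.
Qed.

Lemma limit_le (p q m : R) (Phi : probability config R) :
  free_limit p q Phi ->
  (forall n, (N <= n)%N ->
    m <= rc_mean (@box_clusters n) q (fun=> p)
           (fun B => h (trunc N (config_of B)))) ->
  (m%:E <= \int[Phi]_w (h (trunc N w))%:E)%E.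
Proof.
move=> hPhi hm.
have PhiE A : measurable A -> Phi A = (fine (Phi A))%:E.
  by move=> mA; rewrite fineK // fin_num_measure.
have -> : (\int[Phi]_w (h (trunc N w))%:E)%E =
    (\sum_z h (extend z) * fine (Phi (cylinder z)))%:E.
  under eq_integral do rewrite trunc_cylinders -sumEFin.
  rewrite ge0_integral_sum //; last 2 first.
  - move=> z; apply/measurable_realfun.measurable_EFinP.
    apply: measurable_realfun.measurable_funM => //.
    by apply: measurable_realfun.measurable_indic; apply: measurable_cylinder.
  - by move=> z w _; rewrite lee_fin mulr_ge0 // indicE.
  rewrite -sumEFin; apply: eq_bigr => z _; have mz := measurable_cylinder z.
  rewrite (@integralZl_indic _ _ _ _ _ _ (fun=> cylinder z)) //.
    by rewrite integral_indic // setIT EFinM -PhiE.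
  by move=> /(le_lt_trans (h_ge0 _)); rewrite ltxx.
rewrite lee_fin; apply: (ler_cvg_to (@cvg_cst _ m nat \oo _) _ _); last first.
  exists N => // n /= Nn; apply: le_trans (hm n Nn) _; rewrite rc_mean_trunc.
  exact: lexx.
(* The finite sum converges term by term: cylinders are local, so [hPhi] applies to each. *)
elim: (index_enum _) => [|z r IH].
  under eq_cvg do rewrite big_nil.
  by rewrite big_nil; apply: cvg_cst.
under eq_cvg do rewrite big_cons.
rewrite big_cons; apply: cvgD => //; apply: cvgMr.
have := hPhi _ (cylinder_local z).
by rewrite (PhiE _ (measurable_cylinder z)) => /fine_cvg.
Qed.

End Local.

(** * Lower edges as edges of the finite box, and the conclusion *)

Definition edges_in N (S : {fset edge}) : seq (box_edges N) :=
  [seq g <- enum {: box_edges N} | val g \in S].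

Lemma mem_edges_in N S (g : box_edges N) : (g \in edges_in N S) = (val g \in S).
Proof. by rewrite mem_filter mem_enum andbT. Qed.

Lemma box_config_flip N (w : box_edges N -> bool) g :
  box_config (flip w g) = flip (box_config w) (val g).
Proof.
apply/funext => e; rewrite /flip.
have [eN|eN] := boolP (e \in box_edges N).
  by rewrite -[e]/(val [` eN]%fset) !box_config_val (inj_eq val_inj).
have -> : (e == val g) = false.
  by apply: contraNF eN => /eqP ->; apply: valP.
by rewrite /box_config insubN.
Qed.

(** Flipping a box edge commutes with the extension by closed edges, so pivotality in the box and in
    the lattice agree; as [S] lies in the box, so do the two counts. *)
Lemma piv_weight_box (R : realType) N (A : set config) (s : R)
    (S : {fset edge}) (w : box_edges N -> bool) : (S `<=` box_edges N)%fset ->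
  piv_weight [set x | A (box_config x)] s [fset g in edges_in N S]%fset w =
  piv_weight A s S (box_config w).
Proof.
move=> SN; rewrite /piv_weight.
have pivE g : pivotal A (box_config w) (val g) =
    pivotal [set x | A (box_config x)] w g by rewrite /pivotal -box_config_flip.
congr (_ * _ ^+ _).
rewrite (_ : [fset e in S | pivotal A (box_config w) e]%fset =
  [fset val g | g in [fset g in [fset g in edges_in N S]%fset |
     pivotal [set x | A (box_config x)] w g]%fset]%fset).
  by rewrite [RHS]card_imfset //; apply: val_inj.
apply/fsetP => e; rewrite !inE; apply/andP/imfsetP => /= [[eS piv]|[g]].
  have eN : e \in box_edges N := fsubsetP SN e eS.
  exists [` eN]%fset => //; rewrite !inE mem_edges_in eS /=.
  by rewrite -pivE.
rewrite !inE mem_edges_in => /andP[gS piv] ->; split => //.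
by rewrite pivE.
Qed.

Theorem lemma3p1 (R : realType) (q beta : R) (N : nat)
    (Phi : probability config R) (u v : vertex) (a : R)
    (hq : 1 <= q) (hbeta0 : 0 < beta) (hbeta : beta < beta_c q)
    (hN : (1 <= N)%N)
    (hPhi : free_limit (expR beta - 1) q Phi)
    (hu : u \in box_plus N) (hv : v \in box_plus N)
    (ha0 : 0 <= a) (ha : a < expR beta - 1) :
  ((rc_box N (weight_a N beta a) q (connect_event u v))%:E <=
   'E_Phi[fun w : config => (\1_(connect_event u v) w *
            (1 - eps beta q a) ^+ nb_piv_minus N u v w)%R])%E.
Proof.
set p := expR beta - 1 in hPhi ha *; set A := connect_event u v.
have p0 : 0 <= p by apply: ltW; apply: le_lt_trans ha.
have /andP[e0 e1] : 0 <= eps beta q a <= 1 := penalty_itv hq ha0 ha.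
pose h := piv_weight A (1 - eps beta q a) (edges_minus N).
have s0 : 0 <= 1 - eps beta q a by rewrite subr_ge0.
have s1 : 1 - eps beta q a <= 1 by rewrite gerBl.
have h0 w : 0 <= h w by apply: piv_weight_ge0.
have hle (w w' : config) : (forall e, w e -> w' e) -> h w <= h w'.
  by apply: piv_weight_le => //; apply: connect_event_up.
have trunc_le w e : trunc N w e -> w e by case/andP.
rewrite unlock.
(* The intermediate integral closes the edges outside the box: truncation makes the function local,
   hence suited to the limit, and can only decrease [h]. *)
apply: (@le_trans _ _ (\int[Phi]_w (h (trunc N w))%:E)%E); last first.
  apply: ge0_integral_le_pointwise => w; rewrite lee_fin //.
  by apply: hle => e; apply: trunc_le.
apply: (limit_le h0 hPhi) => n Nn.
apply: le_trans (rc_mean_enlarge Nn p0 hq h0 hle).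
rewrite rc_boxE.
pose C := [set x : box_edges N -> bool | A (box_config x)].
have Cup (w w' : box_edges N -> bool) : (forall e, w e -> w' e) -> C w -> C w'.
  by move=> ww'; apply: connect_event_up; apply: box_config_le.
have wt0 (g : box_edges N) : 0 <= weight_a N beta a (val g).
  by rewrite /weight_a; case: ifP.
have wta (g : box_edges N) :
    g \in edges_in N (edges_minus N) -> weight_a N beta a (val g) = a.
  by rewrite mem_edges_in /weight_a => ->.
have := rc_mean_piv (@box_clusters_supermodular N) (@box_clusters_setU1_le N)
  hq Cup ha0 ha (filter_uniq _ (enum_uniq _)) wt0 wta.
(* Edges outside [edges_in] carry weight [p] from the start, so the restored weights are
   constant. *)
rewrite (_ : (fun g => if g \in _ then p else _) = fun=> p); last first.
  apply/funext => g; case: ifP => //; rewrite mem_edges_in => gS.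
  by rewrite /weight_a gS.
by under [X in _ <= rc_mean _ _ _ X]eq_fun do
  rewrite piv_weight_box ?fset_sub //.
Qed.
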